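(* Let $a_i>0$, $i=1,\ldots,n$, be $n$ positive real numbers and $w_i>0$, $i=1,\ldots,n$, the corresponding weights with $\sum_{i=1}^{n}w_i=1$. If $a_i=O(1)$ for all $i=1,\ldots,n$, and $|a_1-a_i|=O(h)$ for all $i=2,\ldots,n$, then the weighted harmonic mean $H_w$ and the weighted arithmetic mean $M_w:=\sum_{i=1}^{n}w_ia_i$ satisfy $$|M_w-H_w|=O(h^2).$$
   Context: For positive real numbers $a_1,\ldots,a_n$ and weights $w_1,\ldots,w_n>0$ with $\sum_{i=1}^n w_i=1$, the weighted harmonic mean is $H_w=H_w(a_1,\ldots,a_n)=\dfrac{1}{\sum_{i=1}^{n}\frac{w_i}{a_i}}=\dfrac{\prod_{k=1}^{n}a_k}{\sum_{i=1}^{n}w_i\prod_{k=1,\,k\neq i}^{n}a_k}$ and the weighted arithmetic mean is $M_w=M_w(a_1,\ldots,a_n)=\sum_{i=1}^n w_ia_i$. Here $h$ is the small parameter with respect to which the orders $O(\cdot)$ are taken.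
   Formalization: The condition a_i = O(1) is taken to mean of order exactly one (bounded and bounded away from 0 as h → 0+); with only an upper bound the claim fails, e.g. w_1 = w_2 = 1/2, a_1 = h, a_2 = h^2 gives M_w − H_w ~ h/2. *)

(* Defs.v *)
From mathcomp Require Import all_boot all_order all_algebra.
From mathcomp Require Import all_classical all_reals all_analysis.

Set Implicit Arguments.
Unset Strict Implicit.
Unset Printing Implicit Defensive.

Import Order.TTheory GRing.Theory Num.Theory.
Import numFieldNormedType.Exports.

Local Open Scope ring_scope.

(* Asymptotic conventions: orders are taken as h --> 0 with h > 0 (the filter
   0^'+), the data being functions of h.  A bare "a_i = O(1)" for positive data
   means that a_i is of order exactly one, a i =Theta_ (0^'+) (fun=> 1), i.e.
   bounded and bounded away from 0.  An upper bound alone does not give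
   |M_w - H_w| = O(h^2): for w_1 = w_2 = 1/2, a_1 = h and a_2 = h^2,
   M_w - H_w = h (1 - h)^2 / (2 (1 + h)). *)

Definition weighted_arith_mean (R : realType) (n : nat) (w a : 'I_n -> R) : R :=
  \sum_(i < n) w i * a i.

Definition weighted_harm_mean (R : realType) (n : nat) (w a : 'I_n -> R) : R :=
  (\sum_(i < n) w i / a i)^-1.

(* Main.v *)
Require Import Defs.
From mathcomp Require Import all_boot all_order all_algebra.
From mathcomp Require Import all_classical all_reals all_analysis.
From mathcomp Require Import ring.

(** The gap between the two means is the minimum over [c] of a weighted
    dispersion: since [(x - c)^2 / x = x - 2 c + c^2 / x], averaging with
    the weights [w i] gives a decomposition of Koenig-Huygens type around the
    harmonic mean [H],

      [\sum_i w i * ((a i - c)^2 / a i) = (M - H) + (c - H)^2 / H].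

    At [c = H] it shows [0 <= M - H]; for any other [c] it bounds [M - H] by
    the left-hand side, with constant one ([dispersion_decomposition],
    [harm_le_arith], [mean_gap_le_dispersion]).

    Taking [c] to be the first datum, each deviation [a i - c] is [O(h)], so its
    square is [O(h^2)], and this survives the division by [a i] because [a i] is
    bounded away from zero ([sqr_deviation_bigO]).  The weights may vary
    with [h] but never exceed one, so the weighted average of these finitely
    many terms is still [O(h^2)]. *)

Set Implicit Arguments.
Unset Strict Implicit.
Unset Printing Implicit Defensive.

Import Order.TTheory GRing.Theory Num.Theory.
Import numFieldNormedType.Exports.

Local Open Scope ring_scope.
Local Open Scope classical_set_scope.

Lemma weight_le1 (R : numDomainType) (n : nat) (w : 'I_n -> R) (i : 'I_n) :
  (forall j, 0 <= w j) -> \sum_(j < n) w j = 1 -> w i <= 1.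
Proof.
move=> w0 w1; rewrite -w1 (bigD1 i) //= lerDl.
by apply: sumr_ge0 => j _.
Qed.

Lemma weighted_harm_mean_gt0 (R : realType) (n : nat) (w a : 'I_n.+1 -> R) :
  (forall i, 0 < w i) -> (forall i, 0 < a i) -> 0 < weighted_harm_mean w a.
Proof.
move=> w0 a0; rewrite /weighted_harm_mean invr_gt0 big_ord_recl.
apply: ltr_pwDl; first exact: divr_gt0.
by apply: sumr_ge0 => i _; apply/ltW/divr_gt0.
Qed.

(** Expanding [(a i - c)^2 / a i] and summing gives [M - 2 c + c^2 / H]; the
    right-hand side below is this quadratic in [c] with its square completed at
    the minimiser [c = H]. *)
Lemma dispersion_decomposition (R : realType) (n : nat) (w a : 'I_n -> R)
    (c : R) :
  \sum_(i < n) w i = 1 -> (forall i, a i != 0) ->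
  weighted_harm_mean w a != 0 ->
  \sum_(i < n) w i * ((a i - c) ^+ 2 / a i) =
    (weighted_arith_mean w a - weighted_harm_mean w a)
    + (c - weighted_harm_mean w a) ^+ 2 / weighted_harm_mean w a.
Proof.
move=> w1 a0 H0.
have expand i : w i * ((a i - c) ^+ 2 / a i) =
    w i * a i - w i * (2 * c) + w i / a i * c ^+ 2.
  by field; exact: a0.
rewrite (eq_bigr _ (fun i _ => expand i)) big_split sumrB /= -!mulr_suml w1.
have -> : \sum_(i < n) w i / a i = (weighted_harm_mean w a)^-1.
  by rewrite /weighted_harm_mean invrK.
by rewrite -/(weighted_arith_mean w a); field.
Qed.

Lemma harm_le_arith (R : realType) (n : nat) (w a : 'I_n.+1 -> R) :
  (forall i, 0 < w i) -> \sum_(i < n.+1) w i = 1 -> (forall i, 0 < a i) ->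
  weighted_harm_mean w a <= weighted_arith_mean w a.
Proof.
move=> w0 w1 a0; have H0 := weighted_harm_mean_gt0 w0 a0.
have := dispersion_decomposition (weighted_harm_mean w a) w1
  (fun i => lt0r_neq0 (a0 i)) (lt0r_neq0 H0).
rewrite subrr expr0n mul0r addr0 -subr_ge0 => <-.
apply: sumr_ge0 => i _; apply: mulr_ge0; first exact: ltW.
by apply: divr_ge0; [exact: sqr_ge0 | exact: ltW].
Qed.

Lemma mean_gap_le_dispersion (R : realType) (n : nat) (w a : 'I_n.+1 -> R)
    (c : R) :
  (forall i, 0 < w i) -> \sum_(i < n.+1) w i = 1 -> (forall i, 0 < a i) ->
  weighted_arith_mean w a - weighted_harm_mean w a <=
    \sum_(i < n.+1) w i * ((a i - c) ^+ 2 / a i).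
Proof.
move=> w0 w1 a0; have H0 := weighted_harm_mean_gt0 w0 a0.
rewrite (dispersion_decomposition c w1) ?lt0r_neq0// => [|i]; last first.
  exact: lt0r_neq0.
by rewrite lerDl divr_ge0 ?sqr_ge0// ltW.
Qed.

(** Being of order one bounds [f] away from zero, [1 <= m * `|f h|], so that
    dividing by a positive [f h] multiplies the constant by at most [m]. *)
Lemma sqr_deviation_bigO (R : realType) (F : filter_on R) (f g e : R -> R) :
  f =Theta_F (fun=> 1) -> (fun h => `|g h - f h|) =O_F e ->
  exists2 K, 0 < K &
    \forall h \near F, 0 < f h -> (f h - g h) ^+ 2 / f h <= K * (e h) ^+ 2.
Proof.
rewrite eqThetaE bigThetaE eqOmegaO => -[_ /eqO_exP[m m0 fm]].
move=> /eqO_exP[k k0 gf]; exists (k ^+ 2 * m).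
  by rewrite mulr_gt0 ?exprn_gt0.
near=> h => fh0.
have inv_le : (f h)^-1 <= m.
  have : `|1| <= m * `|f h| by near: h.
  by rewrite normr1 (gtr0_norm fh0) -ler_pdivrMr// div1r.
have sqr_le : (f h - g h) ^+ 2 <= k ^+ 2 * e h ^+ 2.
  have : `| `|g h - f h| | <= k * `|e h| by near: h.
  rewrite normr_id distrC => d_le.
  rewrite -(real_normK (num_real (f h - g h))) -(real_normK (num_real (e h))).
  by rewrite -exprMn lerXn2r// nnegrE// mulr_ge0// ltW.
rewrite [leRHS]mulrAC; apply: ler_pM => //; first exact: sqr_ge0.
by rewrite invr_ge0 ltW.
Unshelve. all: by end_near. Qed.

Theorem lemma6 (R : realType) (n : nat) (w a : 'I_n.+1 -> R -> R)
  (w_gt0 : forall i : 'I_n.+1, \forall h \near 0^'+, 0 < w i h)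
  (w_sum1 : \forall h \near 0^'+, \sum_(i < n.+1) w i h = 1)
  (a_gt0 : forall i : 'I_n.+1, \forall h \near 0^'+, 0 < a i h)
  (a_order1 : forall i : 'I_n.+1, a i =Theta_ (0^'+) (fun=> 1))
  (a_close : forall i : 'I_n.+1, i != ord0 ->
     (fun h => `|a ord0 h - a i h|) =O_ (0^'+) (fun h => h)) :
  (fun h => `|weighted_arith_mean (w^~ h) (a^~ h)
              - weighted_harm_mean (w^~ h) (a^~ h)|)
    =O_ (0^'+) (fun h => h ^+ 2).
Proof.
have a_close_all i : (fun h => `|a ord0 h - a i h|) =O_ (0^'+) (fun h : R => h).
  have [->|/a_close//] := eqVneq i ord0.
  apply/eqO_exP; exists 1 => //; apply: nearW => h.
  by rewrite subrr normr0 normr0 mul1r.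
have dev i := sqr_deviation_bigO (a_order1 i) (a_close_all i).
pose K i : R := sval (cid2 (dev i)).
have K0 i : 0 < K i by rewrite /K; case: cid2.
have K_le i : \forall h \near 0^'+,
    0 < a i h -> (a i h - a ord0 h) ^+ 2 / a i h <= K i * h ^+ 2.
  by rewrite /K; case: cid2.
(* Bounding every weight by one, the constants of the individual terms add up
   to one independent of the weights. *)
apply/eqO_exP; exists (\sum_(i < n.+1) K i).
  rewrite big_ord_recl; apply: ltr_pwDl; first exact: K0.
  by apply: sumr_ge0 => i _; exact/ltW/K0.
near=> h.
have w0 : forall i, 0 < w i h by near: h; exact: filter_forall.
have a0 : forall i, 0 < a i h by near: h; exact: filter_forall.
have w1 : \sum_(i < n.+1) w i h = 1 by near: h.
have bound : forall i, 0 < a i h ->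
    (a i h - a ord0 h) ^+ 2 / a i h <= K i * h ^+ 2.
  by near: h; exact: filter_forall.
rewrite normr_id ger0_norm ?subr_ge0; last exact: harm_le_arith.
rewrite [`|_ ^+ 2|]ger0_norm ?sqr_ge0// mulr_suml.
apply: (le_trans (mean_gap_le_dispersion (a ord0 h) w0 w1 a0)).
apply: ler_sum => i _; rewrite -[leRHS]mul1r; apply: ler_pM.
- exact/ltW/w0.
- by rewrite divr_ge0 ?sqr_ge0// ltW.
- by apply: weight_le1 w1 => j; exact/ltW/w0.
- exact: bound.
Unshelve. all: by end_near. Qed.
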